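(* Let $\mathbb K$ be a commutative semiring and let $N\ge 1$ be an integer. Then the set of hypermatrices $\mathbb K(N)=\bigcup_{m,n\ge 0}\mathbb K(N,m,n)$, endowed with the horizontal composition $\leftrightarrow$, the vertical composition $\updownarrow$ and the entrywise $\mathbb K$-module structure on each $\mathbb K(N,m,n)$, is a $\mathbb K$-ModPro.
   Context: Notation: $[N]=\{1,\dots,N\}$; ''module over a semiring'' means semimodule. PRO: a bigraded set $\mathcal P=\bigcup_{m,n\in\mathbb N}\mathcal P_{m,n}$ with operations $\leftrightarrow:\mathcal P_{m,n}\times\mathcal P_{m',n'}\to\mathcal P_{m+m',n+n'}$ (horizontal composition) and $\updownarrow:\mathcal P_{m,n}\times\mathcal P_{n,p}\to\mathcal P_{m,p}$ (vertical composition) such that: both are associative (whenever defined); the interchange law $(p\updownarrow q)\leftrightarrow(p'\updownarrow q')=(p\leftrightarrow p')\updownarrow(q\leftrightarrow q')$ holds for $p\in\mathcal P_{m,n},q\in\mathcal P_{n,r},p'\in\mathcal P_{m',n'},q'\in\mathcal P_{n',r'}$; for each $n$ there is a unique $Id_n\in\mathcal P_{n,n}$ with $Id_m\updownarrow p=p\updownarrow Id_n=p$ for all $p\in\mathcal P_{m,n}$, and $Id_n=Id_1\leftrightarrow\cdots\leftrightarrow Id_1$ ($n$ factors) for $n\ge1$; there is an element $\varepsilon$ with $\varepsilon\leftrightarrow p=p\leftrightarrow\varepsilon=p$ for all $p$. $\mathbb K$-ModPro: a PRO $\mathtt M=\bigcup_{m,n}\mathtt M_{m,n}$ in which each $\mathtt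 M_{m,n}$ is a $\mathbb K$-module (operations $+$ and $\cdot$) such that, whenever the expressions are defined, $p\leftrightarrow(q+r)=(p\leftrightarrow q)+(p\leftrightarrow r)$, $(q+r)\leftrightarrow p=(q\leftrightarrow p)+(r\leftrightarrow p)$, $(p_1+p_2)\updownarrow q=(p_1\updownarrow q)+(p_2\updownarrow q)$, $q\updownarrow(p_1+p_2)=(q\updownarrow p_1)+(q\updownarrow p_2)$, $a\cdot(p\leftrightarrow q)=(a\cdot p)\leftrightarrow q=p\leftrightarrow(a\cdot q)$ and $a\cdot(p\updownarrow q)=(a\cdot p)\updownarrow q=p\updownarrow(a\cdot q)$ for $a\in\mathbb K$. Hypermatrices: $\mathbb K(N,m,n)$ is the set of families $A=(A^I_J)_{I\in[N]^m,J\in[N]^n}$ with $A^I_J\in\mathbb K$; $\mathbb K(N,0,0)=\mathbb K$. For $A\in\mathbb K(N,m,n)$, $B\in\mathbb K(N,m',n')$: $(A\leftrightarrow B)^{II'}_{JJ'}=A^I_J\,B^{I'}_{J'}$ for $I\in[N]^m,I'\in[N]^{m'},J\in[N]^n,J'\in[N]^{n'}$ ($II'$ denotes concatenation). For $A\in\mathbb K(N,m,n)$, $B\in\mathbb K(N,n,p)$: $(A\updownarrow B)^I_J=\sum_{K\in[N]^n}A^I_K B^K_J$. *)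

(* Defs.v *)
From HB Require Import structures.
From mathcomp Require Import all_boot all_algebra.
Set Implicit Arguments.
Unset Strict Implicit.
Unset Printing Implicit Defensive.
Import GRing.Theory.
Local Open Scope ring_scope.

(* Vertical composition relates composable degrees and is stated on the
   components.  The degrees of both sides of horizontal associativity and of
   the unit laws agree only up to a propositional equality of naturals, so
   these laws are stated in the (disjoint) union of the components. *)
Section Pro.

Variable P : nat -> nat -> Type.

Definition bigraded : Type := {d : nat * nat & P d.1 d.2}.

Definition in_bigraded m n (p : P m n) : bigraded :=
  existT (fun d : nat * nat => P d.1 d.2) (m, n) p.

Variable hcomp :
  forall m n m' n', P m n -> P m' n' -> P (m + m')%N (n + n')%N.
Variable vcomp : forall m n p, P m n -> P n p -> P m p.

Local Notation "p <--> q" := (hcomp p q) (at level 45, left associativity).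
Local Notation "p <|> q" := (vcomp p q) (at level 40, left associativity).

Definition bigraded_hcomp (p q : bigraded) : bigraded :=
  in_bigraded (projT2 p <--> projT2 q).

Definition is_vid n (e : P n n) : Prop :=
  (forall r (p : P n r), e <|> p = p) /\ (forall m (p : P m n), p <|> e = p).

(* e <--> ... <--> e with n.+1 factors *)
Fixpoint hiter (e : P 1 1) (n : nat) : P n.+1 n.+1 :=
  if n is k.+1 then e <--> hiter e k else e.

Record is_PRO : Prop := IsPRO {
  pro_hcompA : associative bigraded_hcomp;
  pro_vcompA : forall m n r s (p : P m n) (q : P n r) (t : P r s),
    p <|> (q <|> t) = (p <|> q) <|> t;
  pro_interchange : forall m n r m' n' r'
      (p : P m n) (q : P n r) (p' : P m' n') (q' : P n' r'),
    (p <|> q) <--> (p' <|> q') = (p <--> p') <|> (q <--> q');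
  pro_vid : exists Id : forall n, P n n,
    (forall n, unique (@is_vid n) (Id n)) /\
    (forall n, Id n.+1 = hiter (Id 1%N) n);
  pro_hid : exists eps : bigraded, forall p : bigraded,
    bigraded_hcomp eps p = p /\ bigraded_hcomp p eps = p
}.

End Pro.

Section ModPro.

Variables (K : comPzSemiRingType) (M : nat -> nat -> lSemiModType K).
Variable hcomp :
  forall m n m' n', M m n -> M m' n' -> M (m + m')%N (n + n')%N.
Variable vcomp : forall m n p, M m n -> M n p -> M m p.

Local Notation "p <--> q" := (hcomp p q) (at level 45, left associativity).
Local Notation "p <|> q" := (vcomp p q) (at level 40, left associativity).

Record is_ModPro : Prop := IsModPro {
  modpro_pro : is_PRO (P := fun m n => M m n) hcomp vcomp;
  modpro_hcompDr : forall m n m' n' (p : M m n) (q r : M m' n'),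
    p <--> (q + r) = (p <--> q) + (p <--> r);
  modpro_hcompDl : forall m n m' n' (q r : M m n) (p : M m' n'),
    (q + r) <--> p = (q <--> p) + (r <--> p);
  modpro_vcompDl : forall m n r (p1 p2 : M m n) (q : M n r),
    (p1 + p2) <|> q = (p1 <|> q) + (p2 <|> q);
  modpro_vcompDr : forall m n r (q : M m n) (p1 p2 : M n r),
    q <|> (p1 + p2) = (q <|> p1) + (q <|> p2);
  modpro_hcompZl : forall m n m' n' (a : K) (p : M m n) (q : M m' n'),
    a *: (p <--> q) = (a *: p) <--> q;
  modpro_hcompZr : forall m n m' n' (a : K) (p : M m n) (q : M m' n'),
    a *: (p <--> q) = p <--> (a *: q);
  modpro_vcompZl : forall m n r (a : K) (p : M m n) (q : M n r),
    a *: (p <|> q) = (a *: p) <|> q;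
  modpro_vcompZr : forall m n r (a : K) (p : M m n) (q : M n r),
    a *: (p <|> q) = p <|> (a *: q)
}.

End ModPro.

(* The entry of A with upper multi-index I and lower multi-index J is A (I, J).
   The codomain is K^o so that the library's pointwise semimodule structure on
   finite functions applies. *)
Definition hypermx (K : comPzSemiRingType) (N m n : nat) : Type :=
  {ffun m.-tuple 'I_N * n.-tuple 'I_N -> K^o}.

HB.instance Definition _ (K : comPzSemiRingType) (N m n : nat) :=
  GRing.LSemiModule.on (hypermx K N m n).

Section Hypermatrices.

Variables (K : comPzSemiRingType) (N : nat).

Definition hmx_get m n (A : hypermx K N m n)
  (I : m.-tuple 'I_N) (J : n.-tuple 'I_N) : K := A (I, J).

Lemma hmx_getD m n (A B : hypermx K N m n) I J :
  hmx_get (A + B) I J = hmx_get A I J + hmx_get B I J.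
Proof. by rewrite /hmx_get ffunE. Qed.

Lemma hmx_getZ m n (a : K) (A : hypermx K N m n) I J :
  hmx_get (a *: A) I J = a * hmx_get A I J.
Proof. by rewrite /hmx_get ffunE. Qed.

Definition ltuple m m' (I : (m + m').-tuple 'I_N) : m.-tuple 'I_N :=
  [tuple tnth I (lshift m' i) | i < m].
Definition rtuple m m' (I : (m + m').-tuple 'I_N) : m'.-tuple 'I_N :=
  [tuple tnth I (rshift m i) | i < m'].

(* Defined by splitting the multi-indices; hmx_hcompE below gives the value on
   concatenated multi-indices. *)
Definition hmx_hcomp m n m' n' (A : hypermx K N m n) (B : hypermx K N m' n') :
    hypermx K N (m + m') (n + n') :=
  [ffun IJ => hmx_get A (ltuple IJ.1) (ltuple IJ.2)
            * hmx_get B (rtuple IJ.1) (rtuple IJ.2)].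

Definition hmx_vcomp m n p (A : hypermx K N m n) (B : hypermx K N n p) :
    hypermx K N m p :=
  [ffun IJ => \sum_(L : n.-tuple 'I_N) hmx_get A IJ.1 L * hmx_get B L IJ.2].

Lemma ltuple_cat m m' (I : m.-tuple 'I_N) (I' : m'.-tuple 'I_N) :
  ltuple [tuple of I ++ I'] = I.
Proof. by apply: eq_from_tnth => i; rewrite tnth_mktuple tnth_lshift. Qed.

Lemma rtuple_cat m m' (I : m.-tuple 'I_N) (I' : m'.-tuple 'I_N) :
  rtuple [tuple of I ++ I'] = I'.
Proof. by apply: eq_from_tnth => i; rewrite tnth_mktuple tnth_rshift. Qed.

Lemma hmx_hcompE m n m' n' (A : hypermx K N m n) (B : hypermx K N m' n')
    (I : m.-tuple 'I_N) (I' : m'.-tuple 'I_N)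
    (J : n.-tuple 'I_N) (J' : n'.-tuple 'I_N) :
  hmx_get (hmx_hcomp A B) [tuple of I ++ I'] [tuple of J ++ J']
  = hmx_get A I J * hmx_get B I' J'.
Proof. by rewrite /hmx_get ffunE /= !ltuple_cat !rtuple_cat. Qed.

End Hypermatrices.

(* Main.v *)
Require Import Defs.
From mathcomp Require Import all_boot all_algebra.

Set Implicit Arguments.
Unset Strict Implicit.
Unset Printing Implicit Defensive.
Import GRing.Theory.
Local Open Scope ring_scope.

(** Entrywise, [<|>] is a matrix product over multi-indices and [<-->] is a
    Kronecker product, so every law reduces to an identity between (sums of)
    products of scalars.  Associativity of [<|>], bilinearity and the vertical
    unit laws are those of matrix multiplication, the identity being the
    Kronecker delta [hmx_id].

    Two facts about splitting multi-indices carry the rest.  Cutting a tuple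
    of length m + m' after its first m letters is a bijection onto pairs of
    tuples: hence a sum over [N]^(m + m') is a double sum, which with
    commutativity of K gives the interchange law ([hmx_interchange]), and the
    delta of a concatenation is the product of the deltas ([hmx_hcomp_id]),
    which gives Id_n = Id_1 <--> ... <--> Id_1.  Cutting is moreover insensitive
    to the way the length is written as a sum, because the two pieces are just
    [take] and [drop] of the underlying sequence.  Horizontal associativity and
    the horizontal unit laws relate hypermatrices whose degrees are only
    provably equal; [in_bigraded_ext] turns such an equality into one between
    entries at transported tuples, and transport does not change the underlying
    sequence. *)

Section Splitting.

Variable N : nat.

Lemma val_ltuple m m' (I : (m + m').-tuple 'I_N) :
  ltuple I = take m I :> seq 'I_N.
Proof.
have sz : size (take m I) = m by rewrite size_takel ?size_tuple ?leq_addr.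
case: m I sz => [|m] I sz; first by rewrite take0 tuple0.
have x0 := tnth I ord0.
apply: (@eq_from_nth _ x0) => [|i]; rewrite size_tuple ?sz // => lt_i.
by rewrite (nth_mktuple _ x0 (Ordinal lt_i)) nth_take // (tnth_nth x0).
Qed.

Lemma val_rtuple m m' (I : (m + m').-tuple 'I_N) :
  rtuple I = drop m I :> seq 'I_N.
Proof.
have sz : size (drop m I) = m' by rewrite size_drop size_tuple addKn.
case: m' I sz => [|m'] I sz; first by rewrite tuple0 (size0nil sz).
have x0 := tnth I (rshift m ord0).
apply: (@eq_from_nth _ x0) => [|i]; rewrite size_tuple ?sz // => lt_i.
by rewrite (nth_mktuple _ x0 (Ordinal lt_i)) nth_drop (tnth_nth x0).
Qed.

Lemma cat_lrtuple m m' (I : (m + m').-tuple 'I_N) :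
  [tuple of ltuple I ++ rtuple I] = I.
Proof. by apply: val_inj; rewrite /= val_ltuple val_rtuple cat_take_drop. Qed.

Lemma eq_lrtuple m m' (I J : (m + m').-tuple 'I_N) :
  (I == J) = (ltuple I == ltuple J) && (rtuple I == rtuple J).
Proof.
apply/eqP/andP => [-> //|[/eqP eql /eqP eqr]].
by rewrite -(cat_lrtuple I) -(cat_lrtuple J) eql eqr.
Qed.

(** This is the form in which the interchange law uses that cutting a tuple is
    a bijection. *)
Lemma sum_lrtuple (V : nmodType) m m'
    (F : m.-tuple 'I_N -> m'.-tuple 'I_N -> V) :
  \sum_(L : (m + m').-tuple 'I_N) F (ltuple L) (rtuple L)
  = \sum_(L1 : m.-tuple 'I_N) \sum_(L2 : m'.-tuple 'I_N) F L1 L2.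
Proof.
rewrite pair_bigA /=.
rewrite (reindex (fun L : (m + m').-tuple 'I_N => (ltuple L, rtuple L))) //.
exists (fun LL : m.-tuple 'I_N * m'.-tuple 'I_N =>
          [tuple of LL.1 ++ LL.2]) => [L _ | [L1 L2] _] /=.
  exact: cat_lrtuple.
by rewrite ltuple_cat rtuple_cat.
Qed.

End Splitting.

Section Hypermatrices.

Variables (K : comPzSemiRingType) (N : nat).

Lemma hmx_ext m n (A B : hypermx K N m n) :
  (forall I J, hmx_get A I J = hmx_get B I J) -> A = B.
Proof. by move=> eqAB; apply/ffunP => -[I J]; apply: eqAB. Qed.

Lemma hmx_get_hcomp m n m' n'
    (A : hypermx K N m n) (B : hypermx K N m' n') I J :
  hmx_get (hmx_hcomp A B) I J
  = hmx_get A (ltuple I) (ltuple J) * hmx_get B (rtuple I) (rtuple J).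
Proof. by rewrite {1}/hmx_get ffunE. Qed.

Lemma hmx_get_vcomp m n p (A : hypermx K N m n) (B : hypermx K N n p) I J :
  hmx_get (hmx_vcomp A B) I J = \sum_L hmx_get A I L * hmx_get B L J.
Proof. by rewrite {1}/hmx_get ffunE. Qed.

Definition hmxE := (hmx_getD, hmx_getZ, hmx_get_hcomp, hmx_get_vcomp).

Lemma hmx_vcompA m n r s
    (A : hypermx K N m n) (B : hypermx K N n r) (C : hypermx K N r s) :
  hmx_vcomp A (hmx_vcomp B C) = hmx_vcomp (hmx_vcomp A B) C.
Proof.
apply: hmx_ext => I J; rewrite !hmx_get_vcomp.
under eq_bigr do rewrite hmx_get_vcomp mulr_sumr.
under [RHS]eq_bigr do rewrite hmx_get_vcomp mulr_suml.
rewrite exchange_big; apply: eq_bigr => L _; apply: eq_bigr => L' _.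
exact: mulrA.
Qed.

(** Both sides are sums over the pairs of intermediate multi-indices.
    Commutativity of K is essential: the two sides order the entries of B and
    of A' differently. *)
Lemma hmx_interchange m n r m' n' r'
    (A : hypermx K N m n) (B : hypermx K N n r)
    (A' : hypermx K N m' n') (B' : hypermx K N n' r') :
  hmx_hcomp (hmx_vcomp A B) (hmx_vcomp A' B')
  = hmx_vcomp (hmx_hcomp A A') (hmx_hcomp B B').
Proof.
apply: hmx_ext => I J; rewrite !hmxE big_distrlr -sum_lrtuple.
by apply: eq_bigr => L _; rewrite !hmx_get_hcomp mulrACA.
Qed.

Definition hmx_id n : hypermx K N n n := [ffun IJ => (IJ.1 == IJ.2)%:R].

Lemma hmx_get_id n I J : hmx_get (hmx_id n) I J = (I == J)%:R.
Proof. by rewrite /hmx_get ffunE. Qed.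

Lemma hmx_get_id0 I J : hmx_get (hmx_id 0) I J = 1.
Proof. by rewrite hmx_get_id [I]tuple0 [J]tuple0 eqxx. Qed.

Lemma hmx_vcomp1l n r (A : hypermx K N n r) : hmx_vcomp (hmx_id n) A = A.
Proof.
apply: hmx_ext => I J; rewrite hmx_get_vcomp (bigD1 I) //= big1 => [|L neqLI].
  by rewrite hmx_get_id eqxx mul1r addr0.
by rewrite hmx_get_id eq_sym (negPf neqLI) mul0r.
Qed.

Lemma hmx_vcomp1r m n (A : hypermx K N m n) : hmx_vcomp A (hmx_id n) = A.
Proof.
apply: hmx_ext => I J; rewrite hmx_get_vcomp (bigD1 J) //= big1 => [|L neqLJ].
  by rewrite hmx_get_id eqxx mulr1 addr0.
by rewrite hmx_get_id (negPf neqLJ) mulr0.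
Qed.

Lemma hmx_id_vid n : is_vid (P := hypermx K N) (@hmx_vcomp K N) (hmx_id n).
Proof. by split=> *; rewrite ?hmx_vcomp1l ?hmx_vcomp1r. Qed.

Lemma hmx_hcomp_id m n : hmx_hcomp (hmx_id m) (hmx_id n) = hmx_id (m + n).
Proof.
by apply: hmx_ext => I J; rewrite hmxE !hmx_get_id eq_lrtuple -mulnb natrM.
Qed.

Lemma hmx_id_hiter n :
  hmx_id n.+1 = hiter (P := hypermx K N) (@hmx_hcomp K N) (hmx_id 1) n.
Proof. by elim: n => //= n <-; rewrite hmx_hcomp_id. Qed.

(** Stated with [hmx_get] at transported indices rather than with transported
    hypermatrices, so that the casts fall on tuples, where [val_tcast]
    eliminates them. *)
Lemma in_bigraded_ext m n m' n' (em : m = m') (en : n = n')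
    (A : hypermx K N m n) (B : hypermx K N m' n') :
  (forall I J, hmx_get A I J = hmx_get B (tcast em I) (tcast en J)) ->
  in_bigraded (P := hypermx K N) A = in_bigraded (P := hypermx K N) B.
Proof.
by case: m' / em B; case: n' / en => B eqAB; congr in_bigraded; apply: hmx_ext.
Qed.

(** Splitting after m and then after m' letters gives the same three pieces as
    splitting after m + m' and then after m. *)
Lemma hmx_hcompA :
  associative (bigraded_hcomp (P := hypermx K N) (@hmx_hcomp K N)).
Proof.
move=> [[m n] A] [[m' n'] B] [[m'' n''] C].
apply: (in_bigraded_ext (em := addnA m m' m'') (en := addnA n n' n'')).
move=> I J /=.
rewrite !hmx_get_hcomp mulrA.
congr (_ * _ * _); congr hmx_get; apply: val_inj;
  rewrite /= !(val_ltuple, val_rtuple) val_tcast.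
- by rewrite take_takel ?leq_addr.
- by rewrite take_takel ?leq_addr.
- by rewrite take_drop addnC.
- by rewrite take_drop addnC.
- by rewrite drop_drop addnC.
- by rewrite drop_drop addnC.
Qed.

(** The horizontal unit is the scalar 1, which is also the vertical identity in
    degree (0, 0), so that Id_0 is the empty power of Id_1. *)
Lemma hmx_hcomp_eps (p : bigraded (hypermx K N)) :
  let eps := in_bigraded (P := hypermx K N) (hmx_id 0) in
  bigraded_hcomp (@hmx_hcomp K N) eps p = p /\
  bigraded_hcomp (@hmx_hcomp K N) p eps = p.
Proof.
case: p => -[m n] A; split.
  apply: (in_bigraded_ext (em := add0n m) (en := add0n n)) => I J /=.
  rewrite hmx_get_hcomp hmx_get_id0 mul1r.
  by congr hmx_get; apply: val_inj; rewrite /= val_rtuple val_tcast drop0.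
apply: (in_bigraded_ext (em := addn0 m) (en := addn0 n)) => I J /=.
rewrite hmx_get_hcomp hmx_get_id0 mulr1.
by congr hmx_get; apply: val_inj;
   rewrite /= val_ltuple val_tcast take_oversize // size_tuple addn0.
Qed.

Lemma hmx_PRO :
  is_PRO (P := hypermx K N) (@hmx_hcomp K N) (@hmx_vcomp K N).
Proof.
split.
- exact: hmx_hcompA.
- exact: hmx_vcompA.
- exact: hmx_interchange.
- exists hmx_id; split=> n; last exact: hmx_id_hiter.
  split=> [|e [_ e_idr]]; first exact: hmx_id_vid.
  (* a two-sided identity is unique: Id_n = Id_n <|> e = e *)
  by rewrite -[LHS]e_idr hmx_vcomp1l.
- by eexists => p; apply: hmx_hcomp_eps.
Qed.

End Hypermatrices.

Theorem proposition5 (K : comPzSemiRingType) (N : nat) (hN : (1 <= N)%N) :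
  is_ModPro (K := K) (M := fun m n => hypermx K N m n : lSemiModType K)
    (@hmx_hcomp K N) (@hmx_vcomp K N).
Proof.
split; first exact: hmx_PRO.
- by move=> *; apply: hmx_ext => I J; rewrite !hmxE mulrDr.
- by move=> *; apply: hmx_ext => I J; rewrite !hmxE mulrDl.
- move=> *; apply: hmx_ext => I J; rewrite !hmxE -big_split.
  by apply: eq_bigr => L _; rewrite hmxE mulrDl.
- move=> *; apply: hmx_ext => I J; rewrite !hmxE -big_split.
  by apply: eq_bigr => L _; rewrite hmxE mulrDr.
- by move=> *; apply: hmx_ext => I J; rewrite !hmxE mulrA.
- by move=> *; apply: hmx_ext => I J; rewrite !hmxE mulrCA.
- move=> *; apply: hmx_ext => I J; rewrite !hmxE mulr_sumr.
  by apply: eq_bigr => L _; rewrite hmxE mulrA.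
- move=> *; apply: hmx_ext => I J; rewrite !hmxE mulr_sumr.
  by apply: eq_bigr => L _; rewrite hmxE mulrCA.
Qed.
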